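(* Let $G=(S,A,\downarrow,\to)$ be a labeled transition system, $B\subseteq A$, and let $(\mathcal P,\sqsubseteq)$ be a partition-relation pair over $G$ that is stable with respect to $\downarrow$, $\to$ and $B$. Then for every parent partition $\mathcal P'$ of $\mathcal P$ with $\mathcal P'\neq\mathcal P$ and every splitter $S'$ of $\mathcal P'$ with respect to $\mathcal P$, it holds that $\sigma(\mathcal P,\sqsubseteq,\mathcal P',S')=(\mathcal P,\sqsubseteq)$.
   Context: A labeled transition system $G=(S,A,\downarrow,\to)$ has state set $S$, action set $A$, termination predicate $\downarrow\subseteq S$ and transition relation $\to\subseteq S\times A\times S$ (write $p\xrightarrow{a}q$). A partition-relation pair is $(\mathcal P,\sqsubseteq)$ with $\mathcal P$ a partition of $S$ and $\sqsubseteq$ a partial order on $\mathcal P$. $(\mathcal P,\sqsubseteq)\lhd(\mathcal P',\sqsubseteq')$ iff for all $P\sqsubseteq Q$ in $\mathcal P$ there are $P',Q'\in\mathcal P'$ with $P\subseteq P'$, $Q\subseteq Q'$, $P'\sqsubseteq'Q'$. For a class $P$ write $P\downarrow$ if all its states terminate, $P\not\downarrow$ if none does. For $P,X\subseteq S$: $P\xrightarrow{a}_\exists X$ means some $p\in P$ has $p\xrightarrow{a}x$, $x\in X$; $P\xrightarrow{a}_\forall X$ means every $p\in P$ has some $x\in X$ with $p\xrightarrow{a}x$. For a partition $\mathcal Q$ with partial order $\le$ and $Q\in\mathcal Q$, $\mathrm{lb}_\le(Q)=\bigcup\{R\in\mathcal Q\mid R\le Q\}$, $\mathrm{bb}_\le(Q)=\bigcup\{R\in\mathcal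 Q\mid Q\le R\}$. Stability of $(\mathcal P,\sqsubseteq)$ (w.r.t. $\downarrow,\to,B$): (a) every class has $P\downarrow$ or $P\not\downarrow$; (b) $P\sqsubseteq Q$, $P\downarrow$ imply $Q\downarrow$; (c) for $P,Q,R\in\mathcal P$, $a\in A$: $P\sqsubseteq Q$ and $P\xrightarrow{a}_\exists R$ imply $Q\xrightarrow{a}_\forall\mathrm{bb}_\sqsubseteq(R)$; (d) for $P,Q,R\in\mathcal P$, $b\in B$: $P\sqsubseteq Q$ and $Q\xrightarrow{b}_\exists R$ imply $P\xrightarrow{b}_\forall\mathrm{lb}_\sqsubseteq(R)$. A partition $\mathcal P'$ of $S$ is a parent partition of $\mathcal P$ if every $P\in\mathcal P$ is contained in some $P'\in\mathcal P'$; the relation $\sqsubseteq$ induces $\sqsubseteq'$ on $\mathcal P'$: $P'\sqsubseteq'Q'$ iff there are $P,Q\in\mathcal P$ with $P\subseteq P'$, $Q\subseteq Q'$, $P\sqsubseteq Q$. For $P'\in\mathcal P'$, $S'\subseteq P'$ and $T'=P'\setminus S'$, $S'$ is a splitter of $\mathcal P'$ w.r.t. $\mathcal P$ if every $P\in\mathcal P$ with $P\subseteq P'$ satisfies $P\subseteq S'$ or $P\cap S'=\emptyset$, and (for the relation induced by $\sqsubseteq$ on $S',T'$) either $S'\sqsubseteq'T'$ or $S'$ and $T'$ are unrelated; the splitter partition is $\mathcal P'\setminus\{P'\}\cup\{S',T'\}$. A pair $(\mathcal P,\sqsubseteq)$ with parent partition $\mathcal P'$ (with induced $\sqsubseteq'$),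 where every $P'\in\mathcal P'$ has $P'\downarrow$ or $P'\not\downarrow$, is stable w.r.t. $\mathcal P'$ and $B$ if: (1) for all $P\in\mathcal P$, $a\in A$, $R'\in\mathcal P'$: $P\xrightarrow{a}_\exists R'$ implies $P\xrightarrow{a}_\forall\mathrm{bb}_{\sqsubseteq'}(R')$; (2) for all $P\in\mathcal P$, $b\in B$, $R'\in\mathcal P'$: $P\xrightarrow{b}_\exists R'$ implies $P\xrightarrow{b}_\forall\mathrm{lb}_{\sqsubseteq'}(R')$; (3) for all $P,Q\in\mathcal P$, $a\in A$, $R'\in\mathcal P'$: $P\sqsubseteq Q$ and $P\xrightarrow{a}_\forall R'$ imply $Q\xrightarrow{a}_\forall\mathrm{bb}_{\sqsubseteq'}(R')$; (4) for all $P,Q\in\mathcal P$, $b\in B$, $R'\in\mathcal P'$: $P\sqsubseteq Q$ and $Q\xrightarrow{b}_\forall R'$ imply $P\xrightarrow{b}_\forall\mathrm{lb}_{\sqsubseteq'}(R')$. The refinement operator is $\sigma(\mathcal P,\sqsubseteq,\mathcal P',S')=(\mathcal P_r,\sqsubseteq_r)$, the $\lhd$-coarsest partition-relation pair with $(\mathcal P_r,\sqsubseteq_r)\lhd(\mathcal P,\sqsubseteq)$ that is stable, in the sense of conditions (1)–(4), with respect to the splitter partition $\mathcal P'\setminus\{P'\}\cup\{S',T'\}$. *)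

(* Defs.v *)
From mathcomp Require Import all_boot.
From mathcomp Require Import boolp classical_sets.

Set Implicit Arguments.
Unset Strict Implicit.
Unset Printing Implicit Defensive.

Local Open Scope classical_set_scope.

Record lts (S A : Type) := Lts {
  term : set S;
  trans : S -> A -> set S }.

Definition is_partition S (C : set (set S)) := partition C id setT.

(* [prel] is a relation on the classes only, whence [prel_classes]: it makes
   equality of [prpair]s coincide with equality of partition and relation. *)
Record prpair (S : Type) := PRPair {
  classes : set (set S);
  prel : set S -> set S -> Prop;
  classes_partition : is_partition classes;
  prel_classes : forall P Q, prel P Q -> classes P /\ classes Q;
  prel_refl : forall P, classes P -> prel P P;
  prel_anti : forall P Q, prel P Q -> prel Q P -> P = Q;
  prel_trans : forall P Q R, prel P Q -> prel Q R -> prel P R }.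

Definition finer S (X X' : prpair S) :=
  forall P Q, prel X P Q ->
    exists P' Q', [/\ classes X' P', classes X' Q', P `<=` P', Q `<=` Q' &
                      prel X' P' Q'].

Section Transitions.
Context {S A : Type} (G : lts S A).

Definition terminating (P : set S) := P `<=` term G.
Definition nonterminating (P : set S) := P `<=` ~` term G.

Definition trans_some (P : set S) (a : A) (X : set S) :=
  exists p x, [/\ P p, X x & trans G p a x].

Definition trans_all (P : set S) (a : A) (X : set S) :=
  forall p, P p -> exists x, X x /\ trans G p a x.

End Transitions.

Definition lb S (C : set (set S)) (le : set S -> set S -> Prop) (Q : set S) :=
  \bigcup_(R in [set R | C R /\ le R Q]) R.

Definition bb S (C : set (set S)) (le : set S -> set S -> Prop) (Q : set S) :=
  \bigcup_(R in [set R | C R /\ le Q R]) R.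

Definition stable S A (G : lts S A) (B : set A) (X : prpair S) :=
  [/\ forall P, classes X P -> terminating G P \/ nonterminating G P,
      forall P Q, prel X P Q -> terminating G P -> terminating G Q,
      forall P Q R a, classes X R -> prel X P Q -> trans_some G P a R ->
        trans_all G Q a (bb (classes X) (prel X) R) &
      forall P Q R b, classes X R -> B b -> prel X P Q -> trans_some G Q b R ->
        trans_all G P b (lb (classes X) (prel X) R)].

Definition parent_partition S (X : prpair S) (C' : set (set S)) :=
  is_partition C' /\
  forall P, classes X P -> exists P', C' P' /\ P `<=` P'.

Definition induced S (X : prpair S) (P' Q' : set S) :=
  exists P Q, [/\ P `<=` P', Q `<=` Q' & prel X P Q].

Definition splitter S (X : prpair S) (C' : set (set S)) (P' S' : set S) :=
  let T' := P' `\` S' in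
  [/\ C' P', S' `<=` P',
      forall P, classes X P -> P `<=` P' -> P `<=` S' \/ P `&` S' = set0 &
      induced X S' T' \/ (~ induced X S' T' /\ ~ induced X T' S')].

Definition splitter_partition S (C' : set (set S)) (P' S' : set S) :=
  (C' `\ P') `|` [set S'; P' `\` S'].

(* Only the transition conditions: the classes of [C'] are not required to be
   homogeneous for termination. *)
Definition parent_stable S A (G : lts S A) (B : set A) (X : prpair S)
    (C' : set (set S)) :=
  [/\ forall P a R', classes X P -> C' R' -> trans_some G P a R' ->
        trans_all G P a (bb C' (induced X) R'),
      forall P b R', classes X P -> B b -> C' R' -> trans_some G P b R' ->
        trans_all G P b (lb C' (induced X) R'),
      forall P Q a R', C' R' -> prel X P Q -> trans_all G P a R' ->
        trans_all G Q a (bb C' (induced X) R') &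
      forall P Q b R', B b -> C' R' -> prel X P Q -> trans_all G Q b R' ->
        trans_all G P b (lb C' (induced X) R')].

Definition refinement_candidate S A (G : lts S A) (B : set A) (X : prpair S)
    (C' : set (set S)) (P' S' : set S) (Y : prpair S) :=
  finer Y X /\ parent_stable G B Y (splitter_partition C' P' S').

(* [is_refinement G B X C' P' S' Y]: [Y] is a value of the refinement operator
   sigma at (X, C', S').  The class [P'] that [S'] splits is an argument because
   an empty [S'] does not determine it. *)
Definition is_refinement S A (G : lts S A) (B : set A) (X : prpair S)
    (C' : set (set S)) (P' S' : set S) (Y : prpair S) :=
  refinement_candidate G B X C' P' S' Y /\
  forall Z, refinement_candidate G B X C' P' S' Z -> finer Z Y.

(* Main.v *)
(** Every class of [X] meeting a class of the splitter partition lies inside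
    it, so each stability condition of [X] between classes of [X] coarsens to
    the splitter partition with its induced relation. Hence [X] itself is a
    candidate, and all candidates being [finer] than [X] it is the greatest one;
    antisymmetry of [finer] gives uniqueness. *)
Require Import Defs.
From mathcomp Require Import all_boot.
From mathcomp Require Import boolp classical_sets.

Local Open Scope classical_set_scope.

Section Partition.
Context {S : Type} (C : set (set S)) (hC : is_partition C).

Lemma partition_nonempty P : C P -> exists p, P p.
Proof. by case: hC => _ _ ne /ne [p Pp]; exists p. Qed.

Lemma partition_mem x : exists2 P, C P & P x.
Proof.
case: hC => cov _ _; have : [set: S] x by [].
by rewrite -cov => -[P CP Px]; exists P.
Qed.

Lemma partition_eq P Q x : C P -> C Q -> P x -> Q x -> P = Q.
Proof. by case: hC => _ triv _ CP CQ Px Qx; apply: triv => //; exists x. Qed.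

Lemma partition_subset_eq P Q : C P -> C Q -> P `<=` Q -> P = Q.
Proof.
move=> CP CQ PQ; have [p Pp] := partition_nonempty P CP.
exact: partition_eq CP CQ Pp (PQ _ Pp).
Qed.

End Partition.

Section Finer.
Context {S : Type}.
Implicit Types X Y : prpair S.

(** Extensionality identifies the relations; the remaining fields are proofs, equal by proof
    irrelevance. *)
Lemma prpair_eq X Y :
  classes X = classes Y -> (forall P Q, prel X P Q <-> prel Y P Q) -> X = Y.
Proof.
move=> eC eR; have {}eR : prel X = prel Y.
  by apply/funext => P; apply/funext => Q; apply/propext.
case: X Y eC eR => [C r p1 p2 p3 p4 p5] [C2 r2 q1 q2 q3 q4 q5] /= eC eR.
subst C2 r2.
by rewrite (Prop_irrelevance p1 q1) (Prop_irrelevance p2 q2) (Prop_irrelevance p3 q3)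
  (Prop_irrelevance p4 q4) (Prop_irrelevance p5 q5).
Qed.

Lemma finer_refl X : finer X X.
Proof.
by move=> P Q PQ; have [CP CQ] := prel_classes PQ; exists P, Q; split.
Qed.

(** A class [P] of [X] sits in a class [P1] of [Y], itself inside a class [P2] of [X]. Classes being
    nonempty and disjoint, [P = P2], which squeezes [P1] onto [P]. *)
Lemma finer_classes X Y P : finer X Y -> finer Y X -> classes X P -> classes Y P.
Proof.
move=> XY YX CP; have [P1 [_ [CP1 _ PP1 _ _]]] := XY _ _ (prel_refl CP).
have [P2 [_ [CP2 _ P12 _ _]]] := YX _ _ (prel_refl CP1).
have eP : P = P2.
  have pX := classes_partition X.
  by apply: (partition_subset_eq _ pX P P2 CP CP2) => x /PP1/P12.
suff -> : P = P1 by [].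
by apply/seteqP; split => // x /P12; rewrite -eP.
Qed.

Lemma finer_prel X Y P Q : finer X Y -> finer Y X -> prel X P Q -> prel Y P Q.
Proof.
move=> XY YX PQ; have [CP CQ] := prel_classes PQ.
have [P1 [Q1 [CP1 CQ1 PP1 QQ1 r]]] := XY _ _ PQ.
have pY := classes_partition Y.
(* [P] and [Q] are themselves classes of [Y], so they equal the classes [P1] and [Q1] containing
   them. *)
have -> := partition_subset_eq _ pY P P1 (finer_classes _ _ _ XY YX CP) CP1 PP1.
by have -> := partition_subset_eq _ pY Q Q1 (finer_classes _ _ _ XY YX CQ) CQ1 QQ1.
Qed.

Lemma finer_anti X Y : finer X Y -> finer Y X -> X = Y.
Proof.
move=> XY YX; apply: prpair_eq => [|P Q]; last by split; apply: finer_prel.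
by apply/seteqP; split => P; apply: finer_classes.
Qed.

End Finer.

Section SplitterPartition.
Context {S : Type} (X : prpair S) (C' : set (set S)) (P' S' : set S).
Context (hC' : parent_partition X C') (hS' : splitter X C' P' S').

(** A parent class other than [P'] survives the split; inside [P'] the splitter cuts no class of
    [X], which thus falls on one side. *)
Lemma class_sub_splitter_partition P : classes X P ->
  exists2 R, splitter_partition C' P' S' R & P `<=` R.
Proof.
case: hC' => _ par; case: hS' => _ _ spl _ CP; have [R [CR PR]] := par _ CP.
have [eR|nR] := pselect (R = P'); last by exists R => //; left; split.
rewrite eR in PR; case: (spl _ CP PR) => [PS|PS].
  by exists S' => //; right; left.
exists (P' `\` S'); first by right; right.
move=> x Px; split; first exact: PR.
by move=> Sx; rewrite -[False]/(set0 x) -PS.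
Qed.

(** The shared point [x] determines the parent class around [P]; if that is [P'] and [R] is one of
    its two parts, the splitter condition leaves only the part containing [x]. *)
Lemma class_meet_splitter_partition P R x : classes X P ->
  splitter_partition C' P' S' R -> P x -> R x -> P `<=` R.
Proof.
case: hC' => part' par; case: hS' => CP' SP' spl _ CP CR Px Rx.
have [Q [CQ PQ]] := par _ CP.
have subP' : P' x -> P `<=` P'.
  by move=> P'x; rewrite -(partition_eq _ part' Q P' x) //; apply: PQ.
case: CR => [[CR _]|[eR|eR]].
- by rewrite (partition_eq _ part' R Q x) //; apply: PQ.
- rewrite eR in Rx *; case: (spl _ CP (subP' (SP' _ Rx))) => // PS.
  by have : (P `&` S') x by []; rewrite PS.
- rewrite eR in Rx *; case: Rx => P'x nSx.
  case: (spl _ CP (subP' P'x)) => [PS|PS]; first by case: nSx; apply: PS.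
  move=> y Py; split; first exact: subP'.
  by move=> Sy; rewrite -[False]/(set0 y) -PS.
Qed.

(** A class [Q] above [P] lies in some block [R1], and [P] lies in [R] since they share [x]; the
    pair [P], [Q] then witnesses [induced X R R1]. *)
Lemma bb_splitter_partition P R x : classes X P ->
  splitter_partition C' P' S' R -> P x -> R x ->
  bb (classes X) (prel X) P `<=` bb (splitter_partition C' P' S') (induced X) R.
Proof.
move=> CP CR Px Rx y [Q [CQ PQ] Qy].
have [R1 CR1 QR1] := class_sub_splitter_partition _ CQ.
exists R1; last exact: QR1.
split=> //; exists P, Q; split=> //.
exact: class_meet_splitter_partition CP CR Px Rx.
Qed.

Lemma lb_splitter_partition P R x : classes X P ->
  splitter_partition C' P' S' R -> P x -> R x ->
  lb (classes X) (prel X) P `<=` lb (splitter_partition C' P' S') (induced X) R.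
Proof.
move=> CP CR Px Rx y [Q [CQ QP] Qy].
have [R1 CR1 QR1] := class_sub_splitter_partition _ CQ.
exists R1; last exact: QR1.
split=> //; exists Q, P; split=> //.
exact: class_meet_splitter_partition CP CR Px Rx.
Qed.

Context {A : Type} (G : lts S A) (B : set A).

Lemma trans_all_subset P a (Y Z : set S) :
  Y `<=` Z -> trans_all G P a Y -> trans_all G P a Z.
Proof. by move=> YZ PY p /PY [x [Yx t]]; exists x; split=> //; apply: YZ. Qed.

(** Nonemptiness of classes turns the universal premises of the last two conditions of
    [parent_stable] into existential ones. *)
Lemma trans_all_some P a (Y : set S) :
  classes X P -> trans_all G P a Y -> trans_some G P a Y.
Proof.
move=> CP PY; have [p Pp] := partition_nonempty _ (classes_partition X) _ CP.
by have [x [Yx t]] := PY _ Pp; exists p, x.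
Qed.

Lemma stable_parent_stable :
  stable G B X -> parent_stable G B X (splitter_partition C' P' S').
Proof.
case=> _ _ fwd bwd.
(* An existential premise on an arbitrary related pair covers the first and third conditions at
   once; [down] does the same for the other two. *)
have up P Q a R : splitter_partition C' P' S' R -> prel X P Q ->
    trans_some G P a R ->
    trans_all G Q a (bb (splitter_partition C' P' S') (induced X) R).
  move=> CR PQ [p [x [Pp Rx t]]].
  (* [R] need not be a class of [X], so stability is applied to the class [K] of the target [x]. *)
  have [K CK Kx] := partition_mem _ (classes_partition X) x.
  apply: trans_all_subset (bb_splitter_partition _ _ _ CK CR Kx Rx) _.
  by apply: fwd PQ _ => //; exists p, x.
have down P Q b R : B b -> splitter_partition C' P' S' R -> prel X P Q ->
    trans_some G Q b R ->
    trans_all G P b (lb (splitter_partition C' P' S') (induced X) R).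
  move=> Bb CR PQ [q [x [Qq Rx t]]].
  have [K CK Kx] := partition_mem _ (classes_partition X) x.
  apply: trans_all_subset (lb_splitter_partition _ _ _ CK CR Kx Rx) _.
  by apply: bwd PQ _ => //; exists q, x.
split.
(* The first two conditions are the case of a class related to itself. *)
- by move=> P a R CP CR; apply: up => //; apply: prel_refl.
- by move=> P b R CP Bb CR; apply: down => //; apply: prel_refl.
- move=> P Q a R CR PQ PR; apply: (up _ _ _ _ CR PQ).
  by have [CP _] := prel_classes PQ; apply: trans_all_some.
- move=> P Q b R Bb CR PQ QR; apply: (down _ _ _ _ Bb CR PQ).
  by have [_ CQ] := prel_classes PQ; apply: trans_all_some.
Qed.

End SplitterPartition.

Theorem theorem7 (S A : Type) (G : lts S A) (B : set A) (X : prpair S)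
    (hX : stable G B X)
    (C' : set (set S)) (hC' : parent_partition X C') (hne : C' <> classes X)
    (P' S' : set S) (hS' : splitter X C' P' S') :
  unique (is_refinement G B X C' P' S') X.
Proof.
have candX : refinement_candidate G B X C' P' S' X.
  by split; [exact: finer_refl | exact: stable_parent_stable].
split; first by split=> // Z [].
by move=> Y [[YX _] maxY]; apply: finer_anti => //; apply: maxY.
Qed.
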